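(* Let $\mathcal{A}(t)$ be a function analytic at $t=0$ and let $\{P_n(x)\}_{n\ge0}$ be the polynomial family defined by $e^{xt}\mathcal{A}(t)=\sum_{n\ge0}P_n(x)\frac{t^n}{n!}$. Let $b,c$ be nonzero real constants and suppose $f(u)=b\cdot\mathcal{A}(c\ln u)$ (and that $f$ is analytic on $[0,1]$ with $\int_0^1|f(u)|\,du<\infty$). Then the coefficients $\beta_\nu$ of the asymptotic expansion $\varphi_r\sim\sum_{\nu\ge0}\beta_\nu r^{-\nu-1}$ ($r\to\infty$) of $\varphi_r=\int_0^1 f(u)u^r\,du$, i.e. $\beta_\nu=(-1)^\nu\sum_{\ell=0}^{\nu}{\nu+1\brace \ell+1}f^{(\ell)}(1)$, are given by \[ \beta_\nu=b\,(-1)^\nu c^\nu P_\nu\!\left(\frac1c\right). \]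
   Context: ${n\brace k}$ denotes the Stirling numbers of the second kind. The function $\mathcal{A}$ is called the Appell seed of the Appell-type family $\{P_n\}$; $\mathcal{A}(0)=0$ is allowed. *)

(* Defs.v *)
From Stdlib Require Import Factorial Reals.
From Coquelicot Require Import Coquelicot.

Open Scope R_scope.

(* Functions of a real variable are complex-valued throughout; real-valued
   functions are the special case of values in the image of [RtoC]. *)

Definition analytic_at (f : R -> C) (x0 : R) : Prop :=
  exists a : nat -> C,
    locally x0 (fun x =>
      is_pseries (K := R_AbsRing) (V := C_R_NormedModule) a (x - x0) (f x)).

(* Coquelicot's [Derive_n] is for real-valued functions only. *)
Definition CDerive_n (f : R -> C) (n : nat) (x : R) : C :=
  (Derive_n (fun u => Re (f u)) n x, Derive_n (fun u => Im (f u)) n x).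

Definition Csum (a : nat -> C) (n : nat) : C := sum_n (G := C_AbelianMonoid) a n.

Definition polynomial_fun (p : R -> C) : Prop :=
  exists (d : nat) (a : nat -> C),
    forall x : R, p x = Csum (fun k => Cmult (a k) (RtoC (x ^ k))) d.

(* The generating function identity is required, for each real x, on some
   neighbourhood of t = 0 that may depend on x. *)
Definition appell_family (A : R -> C) (P : nat -> R -> C) : Prop :=
  (forall n : nat, polynomial_fun (P n)) /\
  (forall x : R,
    locally 0 (fun t =>
      is_pseries (K := R_AbsRing) (V := C_R_NormedModule)
        (fun n => Cdiv (P n x) (RtoC (INR (fact n)))) t
        (Cmult (RtoC (exp (x * t))) (A t)))).

Fixpoint stirling2 (n k : nat) {struct n} : nat :=
  match n, k with
  | O, O => 1
  | O, S _ => 0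
  | S _, O => 0
  | S n', S k' => S k' * stirling2 n' (S k') + stirling2 n' k'
  end%nat.

(* [Rpower 0 r] is 1 instead of 0, which does not affect the integral. *)
Definition moment (f : R -> C) (r : R) : C :=
  RInt (V := C_R_CompleteNormedModule)
    (fun u => Cmult (f u) (RtoC (Rpower u r))) 0 1.

(* Poincare expansion phi(r) ~ sum_nu beta_nu r^(-nu-1) as r -> +oo: for every N
   the remainder after the term nu = N is o(r^(-N-1)). *)
Definition asymptotic_expansion (phi : R -> C) (beta : nat -> C) : Prop :=
  forall N : nat,
    filterlim
      (fun r : R =>
        Cmult (RtoC (r ^ (N + 1)))
          (Cminus (phi r)
             (Csum (fun nu => Cmult (beta nu) (RtoC (/ r ^ (nu + 1)))) N)))
      (Rbar_locally p_infty) (locally (RtoC 0)).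

Definition moment_coef (f : R -> C) (nu : nat) : C :=
  Cmult (RtoC ((-1) ^ nu))
    (Csum (fun l => Cmult (RtoC (INR (stirling2 (nu + 1) (l + 1))))
                          (CDerive_n f l 1)) nu).

(* Main.v *)
(* Integrating by parts with u^r = u u^(r-1), the moment of F is
   F(1)/r - (1/r) (moment of (uF)'). Iterating F |-> (uF)' produces, by the
   Stirling recurrence, sum_l S(n+1,l+1) u^l f^(l)(u), while the remainder after
   each step is O(1/r) times the last power of 1/r. For the closed form, put
   u = e^t: the operator becomes d/dt applied to e^t f(e^t), which equals
   b e^t A(ct) for t <= 0, i.e. b times the generating function at x = 1/c
   evaluated at ct. *)
Require Import Defs.
From Stdlib Require Import Arith Lia Lra Reals.
From Coquelicot Require Import Coquelicot.

(* Coquelicot's sums leave the equality at a structure's carrier, which [ring]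
   does not recognize as R. *)
Ltac Rring := match goal with |- @eq _ ?x ?y => change (@eq R x y) end; ring.

Lemma ball_R (x e y : R) : ball x e y <-> Rabs (y - x) < e.
Proof. reflexivity. Qed.

(** * The iterated operator F |-> (u F)' and the Stirling numbers *)

(** Derivatives are two-sided even at 0 and 1; analyticity on a full neighbourhood of each point of
    [0,1] supplies them. *)
Definition smooth_on01 (g : R -> R) : Prop :=
  forall (n : nat) (u : R), 0 <= u <= 1 -> ex_derive_n g n u.

(** On [0,1] this is the result of applying F |-> (u F)' to [g] n times. *)
Definition theta (g : R -> R) (n : nat) (u : R) : R :=
  sum_n (fun l => INR (stirling2 (n + 1) (l + 1)) * u ^ l * Derive_n g l u) n.

Lemma stirling2_gt (n k : nat) : (n < k)%nat -> stirling2 n k = 0%nat.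
Proof.
  revert k; induction n as [|n IH]; intros [|k] H; try lia; simpl; auto.
  rewrite !IH by lia. lia.
Qed.

(** Moving the [b] terms up by one index lengthens the sum by one, and the extra [a] term is zero.
    In the application this is S(n+1,n+2) = 0. *)
Lemma sum_n_shift (a b : nat -> R) (n : nat) :
  a (S n) = 0 ->
  sum_n (fun l => a l + b l) n =
  sum_n (fun l => a l + match l with O => 0 | S k => b k end) (S n).
Proof.
  intros Ha.
  assert (H : forall m, sum_n (fun l => a l + b l) m + a (S m) =
    sum_n (fun l => a l + match l with O => 0 | S k => b k end) (S m)).
  { induction m as [|m IH].
    - rewrite sum_Sn, !sum_O. unfold plus; simpl. Rring.
    - rewrite sum_Sn, (sum_Sn _ (S m)), <- IH. unfold plus; simpl. Rring. }
  rewrite <- H, Ha. now rewrite Rplus_0_r.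
Qed.

Lemma theta_0 (g : R -> R) (u : R) : theta g 0 u = g u.
Proof. unfold theta. rewrite sum_O. simpl. Rring. Qed.

(** The derivative of v^(l+1) g^(l) is (l+1) v^l g^(l) + v^(l+1) g^(l+1). Collecting the terms in
    u^l g^(l) gives the coefficient (l+1) S(n+1,l+1) + S(n+1,l), which is S(n+2,l+1). *)
Lemma is_derive_mul_theta (g : R -> R) (n : nat) (u : R) :
  smooth_on01 g -> 0 <= u <= 1 ->
  is_derive (fun v => v * theta g n v) u (theta g (S n) u).
Proof.
  intros Hg Hu.
  apply is_derive_ext with (fun v => sum_n (fun l =>
    INR (stirling2 (n + 1) (l + 1)) * (v ^ (S l) * Derive_n g l v)) n).
  { intros v. unfold theta. rewrite <- (sum_n_mult_l (K := R_Ring) v).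
    apply sum_n_ext; intros l. unfold mult; simpl. Rring. }
  replace (theta g (S n) u) with (sum_n (fun l =>
    INR (stirling2 (n + 1) (l + 1)) *
      (INR (S l) * u ^ l * Derive_n g l u + u ^ S l * Derive_n g (S l) u)) n).
  { apply (is_derive_sum_n (K := R_AbsRing) (V := R_NormedModule)
      (fun l v => INR (stirling2 (n + 1) (l + 1)) * (v ^ S l * Derive_n g l v))).
    intros l _. apply is_derive_scal.
    apply (is_derive_mult (fun v => v ^ S l) (Derive_n g l) u).
    - evar_last. apply is_derive_pow, is_derive_id. unfold one; simpl. ring.
    - apply Derive_correct. exact (Hg (S l) u Hu).
    - intros; apply Rmult_comm. }
  rewrite (sum_n_ext _ (fun l =>
    INR (stirling2 (n + 1) (l + 1)) * INR (S l) * u ^ l * Derive_n g l u +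
    INR (stirling2 (n + 1) (l + 1)) * (u ^ S l * Derive_n g (S l) u)))
    by (intros; Rring).
  rewrite (sum_n_shift
    (fun l => INR (stirling2 (n + 1) (l + 1)) * INR (S l) * u ^ l * Derive_n g l u)
    (fun l => INR (stirling2 (n + 1) (l + 1)) * (u ^ S l * Derive_n g (S l) u))).
  2: rewrite stirling2_gt by lia; simpl; ring.
  apply sum_n_ext; intros l.
  replace (S n + 1)%nat with (S (n + 1)) by lia.
  replace (l + 1)%nat with (S l) by lia.
  change (stirling2 (S (n + 1)) (S l)) with
    (S l * stirling2 (n + 1) (S l) + stirling2 (n + 1) l)%nat.
  rewrite plus_INR, mult_INR.
  (* For l = 0 no shifted term arrives, in accordance with S(n+1,0) = 0. *)
  destruct l as [|k].
  - replace (n + 1)%nat with (S n) by lia. change (stirling2 (S n) 0) with 0%nat.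
    simpl INR. Rring.
  - replace (k + 1)%nat with (S k) by lia. Rring.
Qed.

Lemma ex_derive_theta (g : R -> R) (n : nat) (u : R) :
  smooth_on01 g -> 0 <= u <= 1 -> ex_derive (theta g n) u.
Proof.
  intros Hg Hu. eexists. unfold theta.
  apply (is_derive_sum_n (K := R_AbsRing) (V := R_NormedModule)
    (fun l v => INR (stirling2 (n + 1) (l + 1)) * v ^ l * Derive_n g l v)
    n u (fun l => Derive (fun v => INR (stirling2 (n + 1) (l + 1)) * v ^ l * Derive_n g l v) u)).
  intros l _. apply Derive_correct.
  apply (ex_derive_mult (fun v => INR (stirling2 (n + 1) (l + 1)) * v ^ l)).
  - auto_derive; auto.
  - exact (Hg (S l) u Hu).
Qed.

(** * Powers u^r extended by 0, and integration by parts *)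

(* [Rpower u r] equals 1 for u <= 0, hence has a jump at 0. *)
Definition pospow (r u : R) : R :=
  if Rle_dec u 0 then 0 else Rpower u r.

Lemma pospow_pos (r u : R) : 0 < u -> pospow r u = Rpower u r.
Proof. intros; unfold pospow; destruct (Rle_dec u 0); lra. Qed.

Lemma pospow_le0 (r u : R) : u <= 0 -> pospow r u = 0.
Proof. intros; unfold pospow; destruct (Rle_dec u 0); lra. Qed.

Lemma mul_pospow (r u : R) : u * pospow (r - 1) u = pospow r u.
Proof.
  unfold pospow; destruct (Rle_dec u 0); [ring|].
  replace r with (1 + (r - 1)) at 2 by ring.
  rewrite Rpower_plus, Rpower_1 by lra. ring.
Qed.

Lemma Rabs_pospow_le1 (r u : R) : 0 <= r -> u <= 1 -> Rabs (pospow r u) <= 1.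
Proof.
  intros Hr Hu. unfold pospow. destruct (Rle_dec u 0).
  - rewrite Rabs_R0; lra.
  - rewrite Rabs_pos_eq by (left; apply exp_pos).
    unfold Rpower. rewrite <- exp_0 at 1.
    assert (Hl : ln u <= 0) by (rewrite <- ln_1; apply ln_le; lra).
    assert (H : r * ln u <= 0) by nra.
    destruct H as [H|H]; [left; now apply exp_increasing | rewrite H; lra].
Qed.

(** The delicate point is 0, where the difference quotient is [h * pospow (r - 2) h]. For 2 <= r and
    |h| < 1 its absolute value is at most |h|, so the derivative there is 0. *)
Lemma is_derive_pospow (r u : R) :
  2 <= r -> is_derive (pospow r) u (r * pospow (r - 1) u).
Proof.
  intros Hr. destruct (total_order_T u 0) as [[Hu|Hu]|Hu].
  - apply is_derive_ext_loc with (fun _ => 0).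
    + exists (mkposreal (- u) ltac:(lra)). intros y Hy.
      symmetry; apply pospow_le0.
      apply -> ball_R in Hy. simpl in Hy.
      apply Rabs_def2 in Hy. lra.
    + rewrite pospow_le0 by lra. rewrite Rmult_0_r. apply @is_derive_const.
  - subst u. rewrite pospow_le0, Rmult_0_r by lra.
    apply is_derive_Reals. intros eps Heps.
    exists (mkposreal (Rmin 1 eps) (Rmin_pos 1 eps Rlt_0_1 Heps)).
    intros h Hh Hd. simpl in Hd.
    rewrite Rplus_0_l, (pospow_le0 r 0) by lra.
    replace ((pospow r h - 0) / h - 0) with (h * pospow (r - 2) h).
    + rewrite Rabs_mult.
      assert (H1 := Rmin_l 1 eps). assert (H2 := Rmin_r 1 eps).
      assert (H3 : Rabs (pospow (r - 2) h) <= 1).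
      { apply Rabs_pospow_le1. lra. generalize (Rle_abs h); lra. }
      generalize (Rabs_pos h) (Rabs_pos (pospow (r - 2) h)). nra.
    + rewrite <- (mul_pospow r h), <- (mul_pospow (r - 1) h).
      replace (r - 1 - 1) with (r - 2) by ring. field; exact Hh.
  - apply is_derive_ext_loc with (fun v => Rpower v r).
    + exists (mkposreal u Hu). intros y Hy.
      symmetry; apply pospow_pos.
      apply -> ball_R in Hy. simpl in Hy.
      apply Rabs_def2 in Hy. lra.
    + rewrite pospow_pos by exact Hu.
      apply is_derive_Reals, derivable_pt_lim_power; exact Hu.
Qed.

(* Since u^r = u u^(r-1), the boundary term of the integration by parts is
   F(1)/r and the new integrand is (u F)' u^r, with the same exponent r. *)
Lemma is_RInt_pospow (F dF : R -> R) (r : R) :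
  3 <= r ->
  (forall u, 0 <= u <= 1 -> is_derive (fun v => v * F v) u (dF u)) ->
  (forall u, 0 <= u <= 1 -> continuous F u) ->
  (forall u, 0 <= u <= 1 -> continuous dF u) ->
  ex_RInt (fun u => F u * pospow r u) 0 1 /\
  RInt (fun u => F u * pospow r u) 0 1 =
    F 1 / r - RInt (fun u => dF u * pospow r u) 0 1 / r.
Proof.
  intros Hr HD HF HdF.
  assert (Hc : forall s u, 2 <= s -> continuous (pospow s) u).
  { intros s u Hs. apply (ex_derive_continuous (pospow s)).
    eexists; now apply is_derive_pospow. }
  assert (E : forall G, (forall u, 0 <= u <= 1 -> continuous G u) ->
    ex_RInt (fun u => G u * pospow r u) 0 1).
  { intros G HG. apply (ex_RInt_continuous (V := R_CompleteNormedModule)). intros u Hu.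
    rewrite Rmin_left, Rmax_right in Hu by lra.
    apply (continuous_mult G (pospow r)); [now apply HG | apply Hc; lra]. }
  split; [now apply E|].
  (* The integrand is the derivative of v F(v) v^r, since u * r u^(r-1) = r u^r. The boundary value
     at 0 vanishes through the factor v. *)
  assert (I : is_RInt (fun u => dF u * pospow r u + r * (F u * pospow r u)) 0 1 (F 1)).
  { evar_last.
    apply (is_RInt_derive (V := R_CompleteNormedModule) (fun v => (v * F v) * pospow r v)).
    - intros u Hu. rewrite Rmin_left, Rmax_right in Hu by lra.
      evar_last.
      apply (is_derive_mult (fun v => v * F v) (pospow r) u (dF u) (r * pospow (r - 1) u)).
      + now apply HD.
      + apply is_derive_pospow; lra.
      + intros; apply Rmult_comm.
      + unfold plus, mult; simpl. rewrite <- (mul_pospow r u). ring.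
    - intros u Hu. rewrite Rmin_left, Rmax_right in Hu by lra.
      apply (continuous_plus (fun u => dF u * pospow r u)).
      + apply (continuous_mult dF (pospow r)); [now apply HdF | apply Hc; lra].
      + apply (continuous_mult (fun _ => r)); [apply continuous_const|].
        apply (continuous_mult F (pospow r)); [now apply HF | apply Hc; lra].
    - unfold minus, plus, opp; simpl. rewrite pospow_pos by lra.
      unfold Rpower. rewrite ln_1, Rmult_0_r, exp_0. ring. }
  assert (J := RInt_correct _ _ _ (E F HF)).
  assert (K := RInt_correct _ _ _ (E dF HdF)).
  assert (L := is_RInt_plus _ _ _ _ _ _ K (is_RInt_scal _ _ _ r _ J)).
  assert (X := is_RInt_unique _ _ _ _ I).
  assert (Y := is_RInt_unique _ _ _ _ L).
  unfold plus, scal in Y; simpl in Y; unfold mult in Y; simpl in Y.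
  rewrite X in Y. rewrite Y. apply Rminus_diag_uniq. field. lra.
Qed.

(** * Asymptotic expansion of real moments: existence and uniqueness *)

Definition real_expansion (phi : R -> R) (beta : nat -> R) : Prop :=
  forall N : nat,
    filterlim
      (fun r : R => r ^ (N + 1) *
        (phi r - sum_n (fun nu => beta nu * / r ^ (nu + 1)) N))
      (Rbar_locally p_infty) (locally 0).

Definition real_coef (g : R -> R) (nu : nat) : R := (-1) ^ nu * theta g nu 1.

Lemma continuous_theta (g : R -> R) (n : nat) (u : R) :
  smooth_on01 g -> 0 <= u <= 1 -> continuous (theta g n) u.
Proof. intros Hg Hu. apply (ex_derive_continuous (theta g n)). now apply ex_derive_theta. Qed.

Lemma RInt_theta (g : R -> R) (n : nat) (r : R) :
  smooth_on01 g -> 3 <= r ->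
  ex_RInt (fun u => theta g n u * pospow r u) 0 1 /\
  RInt (fun u => theta g n u * pospow r u) 0 1 =
    theta g n 1 / r - RInt (fun u => theta g (S n) u * pospow r u) 0 1 / r.
Proof.
  intros Hg Hr. apply is_RInt_pospow; auto using continuous_theta, is_derive_mul_theta.
Qed.

(** Each integration by parts splits off one coefficient and leaves an exact remainder, so the
    expansion reduces to showing that the remaining integral tends to 0. *)
Lemma RInt_theta_remainder (g : R -> R) (N : nat) (r : R) :
  smooth_on01 g -> 3 <= r ->
  r ^ (N + 1) * (RInt (fun u => theta g 0 u * pospow r u) 0 1 -
    sum_n (fun nu => real_coef g nu * / r ^ (nu + 1)) N) =
  (-1) ^ (N + 1) * RInt (fun u => theta g (S N) u * pospow r u) 0 1.
Proof.
  intros Hg Hr. induction N as [|N IH].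
  - rewrite sum_O, (proj2 (RInt_theta g 0 r Hg Hr)). unfold real_coef. simpl. field. lra.
  - rewrite sum_Sn. unfold plus; simpl.
    rewrite (proj2 (RInt_theta g (S N) r Hg Hr)) in IH.
    assert (Hp : r ^ (N + 1) <> 0) by (apply pow_nonzero; lra).
    (* With [d] the previous unscaled remainder, the next scaled remainder is r times the previous
       one minus the new coefficient. *)
    match goal with |- _ * (?a - (?s + _)) = _ => set (d := a - s) in *;
      transitivity (r * (r ^ (N + 1) * d) - real_coef g (S N)) end.
    { unfold d. field. split; [exact Hp | lra]. }
    rewrite IH. unfold real_coef.
    replace (N + 1)%nat with (S N) by lia.
    change ((-1) ^ S N) with (-1 * (-1) ^ N). field. lra.
Qed.

(** One further integration by parts bounds the integral by (|theta_n(1)| + M) / r, where M bounds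
    theta_(n+1) on [0,1] and |u^r| <= 1. *)
Lemma RInt_theta_lim (g : R -> R) (n : nat) :
  smooth_on01 g ->
  is_lim (fun r => RInt (fun u => theta g n u * pospow r u) 0 1) p_infty 0.
Proof.
  intros Hg.
  destruct (bounded_continuity (theta g (S n)) 0 1) as [M HM].
  { intros; now apply continuous_theta. }
  assert (HM0 : 0 <= M).
  { left; apply Rle_lt_trans with (1 := Rabs_pos (theta g (S n) 0)). apply (HM 0); lra. }
  set (C := Rabs (theta g n 1) + M).
  assert (L : forall k, is_lim (fun r => k * / r) p_infty 0).
  { intros k. replace (Finite 0) with (Rbar_mult k 0) by (simpl; f_equal; ring).
    apply is_lim_scal_l. apply (is_lim_inv (fun r => r) p_infty p_infty).
    apply is_lim_id. discriminate. }
  apply is_lim_le_le_loc with (fun r => - C * / r) (fun r => C * / r); try apply L.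
  exists 3. intros r Hr.
  rewrite (proj2 (RInt_theta g n r Hg ltac:(lra))).
  assert (B : Rabs (RInt (fun u => theta g (S n) u * pospow r u) 0 1) <= (1 - 0) * M).
  { apply abs_RInt_le_const; [lra | apply RInt_theta; auto; lra|].
    intros t Ht. rewrite Rabs_mult.
    assert (H1 := Rabs_pospow_le1 r t ltac:(lra) (proj2 Ht)).
    assert (H2 : Rabs (theta g (S n) t) < M) by exact (HM t Ht).
    generalize (Rabs_pos (theta g (S n) t)) (Rabs_pos (pospow r t)). nra. }
  set (I := RInt _ 0 1) in *.
  assert (Hi : 0 < / r) by (apply Rinv_0_lt_compat; lra).
  assert (T1 := Rle_abs (theta g n 1)). assert (T2 := Rle_abs (- theta g n 1)).
  rewrite Rabs_Ropp in T2.
  assert (I1 := Rle_abs I). assert (I2 := Rle_abs (- I)). rewrite Rabs_Ropp in I2.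
  unfold C, Rdiv. split; nra.
Qed.

Lemma real_moment_expansion (g phi : R -> R) :
  smooth_on01 g ->
  (forall r, 3 <= r -> phi r = RInt (fun u => g u * pospow r u) 0 1) ->
  real_expansion phi (real_coef g).
Proof.
  intros Hg Hphi N.
  assert (L := RInt_theta_lim g (S N) Hg).
  apply (is_lim_scal_l _ ((-1) ^ (N + 1))) in L.
  simpl in L. rewrite Rmult_0_r in L.
  eapply filterlim_ext_loc; [|exact L].
  exists 3. intros r Hr. simpl.
  rewrite <- RInt_theta_remainder by (auto; lra).
  rewrite Hphi by lra. do 2 f_equal.
  apply RInt_ext. intros u _. now rewrite theta_0.
Qed.

Lemma real_expansion_ext (phi : R -> R) (a b : nat -> R) :
  (forall n, a n = b n) -> real_expansion phi a -> real_expansion phi b.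
Proof.
  intros E H N. eapply filterlim_ext; [|exact (H N)].
  intros r; cbv beta. do 2 f_equal. apply sum_n_ext. intros n. now rewrite E.
Qed.

(** By strong induction the terms before n cancel in the difference of the two scaled remainders of
    order n. What is left is the constant [a n - b n], whose limit is 0. *)
Lemma real_expansion_unique (phi : R -> R) (a b : nat -> R) :
  real_expansion phi a -> real_expansion phi b -> forall n, a n = b n.
Proof.
  intros Ha Hb n. induction n as [n IH] using lt_wf_ind.
  assert (L := is_lim_minus' _ _ p_infty 0 0 (Hb n) (Ha n)).
  assert (K : is_lim (fun _ => a n - b n) p_infty (0 - 0)).
  { eapply is_lim_ext_loc; [|exact L]. exists 1. intros r Hr.
    assert (Hp : r ^ (n + 1) <> 0) by (apply pow_nonzero; lra).
    destruct n as [|m].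
    - rewrite !sum_O. field. exact Hp.
    - rewrite !sum_Sn. unfold plus; simpl plus.
      rewrite (sum_n_ext_loc (fun nu => a nu * / r ^ (nu + 1))
        (fun nu => b nu * / r ^ (nu + 1)) m) by (intros; rewrite IH by lia; reflexivity).
      simpl. simpl in Hp. field.
      split; [|lra]. intros H; apply Hp; rewrite H; ring. }
  apply is_lim_unique in K. rewrite Lim_const in K. injection K. lra.
Qed.

(** * Iterated derivatives of power series and the closed form of theta at 1 *)

Definition PS_derive_iter (n : nat) (q : nat -> R) : nat -> R := Nat.iter n PS_derive q.

Lemma PS_derive_iter_coef (n : nat) (q : nat -> R) (k : nat) :
  PS_derive_iter n q k = INR (fact (k + n)) / INR (fact k) * q (k + n)%nat.
Proof.
  revert k; induction n as [|n IH]; intros k.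
  - rewrite Nat.add_0_r. simpl. field. apply INR_fact_neq_0.
  - change (PS_derive_iter (S n) q k) with (INR (S k) * PS_derive_iter n q (S k)).
    rewrite IH. replace (S k + n)%nat with (k + S n)%nat by lia.
    rewrite (fact_simpl k), mult_INR. field.
    split; [apply INR_fact_neq_0 | apply not_0_INR; lia].
Qed.

Lemma CV_radius_derive_iter (n : nat) (q : nat -> R) :
  CV_radius (PS_derive_iter n q) = CV_radius q.
Proof.
  induction n as [|n IH]; [reflexivity|].
  change (PS_derive_iter (S n) q) with (PS_derive (PS_derive_iter n q)).
  now rewrite CV_radius_derive.
Qed.

(** By continuity both values are left limits at x, and left limits are unique. *)
Lemma continuous_eq_left (h k : R -> R) (x : R) :
  continuous h x -> continuous k x -> at_left x (fun t => h t = k t) -> h x = k x.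
Proof.
  intros Hh Hk E.
  apply (filterlim_locally_unique (F := at_left x) h).
  - eapply filterlim_filter_le_1; [|exact Hh]. apply filter_le_within.
  - eapply (filterlim_ext_loc (F := at_left x) k).
    + revert E. apply filter_imp. auto.
    + eapply filterlim_filter_le_1; [|exact Hk]. apply filter_le_within.
Qed.

(* Both sides have all derivatives at 0 and agree to the left of 0, so all
   their derivatives agree at 0. *)
Lemma theta_1_of_pseries (g : R -> R) (q : nat -> R) (b c d : R) :
  smooth_on01 g -> 0 < d ->
  (forall t, - d < t <= 0 -> Rbar_lt (Rabs (c * t)) (CV_radius q)) ->
  (forall t, - d < t < 0 -> exp t * g (exp t) = b * PSeries q (c * t)) ->
  forall n, theta g n 1 = b * c ^ n * (INR (fact n) * q n).
Proof.
  intros Hg Hd HR H n.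
  assert (Hexp : forall t, t <= 0 -> 0 <= exp t <= 1).
  { intros t Ht. split; [left; apply exp_pos|]. rewrite <- exp_0.
    destruct Ht as [Ht|Ht]; [left; now apply exp_increasing | rewrite Ht; lra]. }
  (* Under v = e^s the operator becomes plain differentiation of e^s theta_m(e^s). *)
  assert (Dexp : forall m t, t <= 0 ->
    is_derive (fun s => exp s * theta g m (exp s)) t (exp t * theta g (S m) (exp t))).
  { intros m t Ht.
    apply (is_derive_comp (fun v => v * theta g m v) exp t).
    - apply is_derive_mul_theta; auto.
    - apply is_derive_exp. }
  assert (Dq : forall m t, - d < t <= 0 ->
    is_derive (fun s => b * c ^ m * PSeries (PS_derive_iter m q) (c * s)) t
      (b * c ^ S m * PSeries (PS_derive_iter (S m) q) (c * t))).
  { intros m t Ht. evar_last.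
    - apply is_derive_scal, (is_derive_comp (PSeries (PS_derive_iter m q)) (fun s => c * s)).
      + apply is_derive_PSeries. rewrite CV_radius_derive_iter. now apply HR.
      + apply is_derive_scal, is_derive_id.
    - unfold scal, one; simpl; unfold mult; simpl.
      change (PS_derive_iter (S m) q) with (PS_derive (PS_derive_iter m q)). Rring. }
  (* On the open interval the identity [H] can be differentiated m times. *)
  assert (E : forall m t, - d < t < 0 ->
    exp t * theta g m (exp t) = b * c ^ m * PSeries (PS_derive_iter m q) (c * t)).
  { induction m as [|m IH]; intros t Ht.
    - rewrite theta_0, H by exact Ht. simpl. ring.
    - rewrite <- (is_derive_unique _ _ _ (Dexp m t ltac:(lra))).
      rewrite <- (is_derive_unique _ _ _ (Dq m t ltac:(lra))).
      apply Derive_ext_loc.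
      apply (locally_interval _ t (Finite (- d)) (Finite 0)); simpl; try lra.
      intros y H1 H2. apply IH. lra. }
  (* Continuity carries the identity to t = 0, where only the constant term n! q_n of the
     differentiated series survives. *)
  assert (X : exp 0 * theta g n (exp 0) = b * c ^ n * PSeries (PS_derive_iter n q) (c * 0)).
  { apply (continuous_eq_left (fun t => exp t * theta g n (exp t))
      (fun t => b * c ^ n * PSeries (PS_derive_iter n q) (c * t))).
    - apply (ex_derive_continuous (fun t => exp t * theta g n (exp t))).
      eexists. apply Dexp; lra.
    - apply (ex_derive_continuous (fun t => b * c ^ n * PSeries (PS_derive_iter n q) (c * t))).
      eexists. apply Dq; lra.
    - exists (mkposreal d Hd). intros y Hy Hy0. apply E.
      apply -> ball_R in Hy. simpl in Hy.
      apply Rabs_def2 in Hy. lra. }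
  rewrite exp_0, Rmult_0_r, PSeries_0, PS_derive_iter_coef in X. simpl in X.
  rewrite Rmult_1_l in X. rewrite X. field.
Qed.

(** The series converges at the midpoint z of |y| and [eps]. Were the radius below z, its terms at z
    would not tend to 0; hence |y| < z <= radius. *)
Lemma CV_radius_of_ball (a : nat -> R) (l : R -> R) (eps : posreal) :
  (forall y, Rabs y < eps -> is_pseries a y (l y)) ->
  forall y, Rabs y < eps -> Rbar_lt (Rabs y) (CV_radius a).
Proof.
  intros H y Hy.
  assert (P := cond_pos eps). assert (Hy0 := Rabs_pos y).
  set (z := (Rabs y + eps) / 2).
  assert (Hz : Rabs z = z) by (apply Rabs_pos_eq; unfold z; lra).
  apply Rbar_lt_le_trans with z; [simpl; unfold z; lra|].
  apply Rbar_not_lt_le. intros Hlt. rewrite <- Hz in Hlt.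
  apply (CV_disk_outside a z Hlt).
  apply ex_series_lim_0. exists (l z).
  apply is_pseries_R, H. rewrite Hz. unfold z; lra.
Qed.

(** * Passage from complex to real values through a linear functional *)

Section LinearFunctional.

(** Stands for [Re] and [Im], so that each transfer is proved once. [is_linear] includes
    boundedness, hence continuity, and limits pass through [pr]. *)
Context (pr : C -> R).
Context (Hpr : is_linear (U := C_R_NormedModule) (V := R_NormedModule) pr).

Lemma linear_Cplus (z w : C) : pr (Cplus z w) = pr z + pr w.
Proof. exact (linear_plus _ Hpr z w). Qed.

Lemma linear_Cmult_l (k : R) (z : C) : pr (Cmult (RtoC k) z) = k * pr z.
Proof. rewrite <- scal_R_Cmult. exact (linear_scal _ Hpr k z). Qed.

Lemma linear_Cmult_r (k : R) (z : C) : pr (Cmult z (RtoC k)) = k * pr z.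
Proof. rewrite Cmult_comm. apply linear_Cmult_l. Qed.

Lemma linear_Cminus (z w : C) : pr (Cminus z w) = pr z - pr w.
Proof.
  replace (Cminus z w) with (Cplus z (Cmult (RtoC (-1)) w)).
  - rewrite linear_Cplus, linear_Cmult_l. ring.
  - apply injective_projections; simpl; ring.
Qed.

Lemma linear_Csum (a : nat -> C) (n : nat) :
  pr (Csum a n) = sum_n (fun k => pr (a k)) n.
Proof.
  unfold Csum. induction n as [|n IH].
  - now rewrite !sum_O.
  - rewrite !sum_Sn. etransitivity; [apply linear_Cplus|]. now rewrite IH.
Qed.

Lemma is_pseries_linear (a : nat -> C) (x : R) (l : C) :
  is_pseries (K := R_AbsRing) (V := C_R_NormedModule) a x l ->
  is_pseries (fun n => pr (a n)) x (pr l).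
Proof.
  intros H.
  eapply filterlim_ext; [|eapply filterlim_comp; [exact H
    | exact (linear_cont (U := C_R_NormedModule) pr _ Hpr)]].
  intros n; simpl. induction n as [|n IH].
  - rewrite !sum_O. apply (linear_scal _ Hpr).
  - rewrite !sum_Sn, (linear_plus _ Hpr), (linear_scal _ Hpr). now rewrite IH.
Qed.

(** Near u the function is a translated real power series with positive radius of convergence. *)
Lemma analytic_at_linear (f : R -> C) (u : R) :
  analytic_at f u -> forall n, ex_derive_n (fun v => pr (f v)) n u.
Proof.
  intros [a [eps H]] n.
  assert (Hps : forall y, Rabs y < eps -> is_pseries (fun k => pr (a k)) y (pr (f (y + u)))).
  { intros y Hy. apply is_pseries_linear.
    replace y with (y + u - u) at 1 by ring. apply H.
    apply ball_R. now replace (y + u - u) with y by ring. }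
  apply ex_derive_n_ext_loc with (fun v => PSeries (fun k => pr (a k)) (v + - u)).
  - exists eps. intros y Hy.
    apply -> ball_R in Hy. simpl in Hy.
    change (y + - u) with (y - u).
    rewrite (is_pseries_unique _ _ _ (Hps _ Hy)). do 2 f_equal. ring.
  - apply ex_derive_n_comp_trans, ex_derive_n_PSeries.
    apply (CV_radius_of_ball _ _ eps Hps). rewrite Rplus_opp_r, Rabs_R0. apply cond_pos.
Qed.

Lemma linear_remainder (z : C) (beta : nat -> C) (r : R) (N : nat) :
  pr (Cmult (RtoC (r ^ (N + 1)))
        (Cminus z (Csum (fun nu => Cmult (beta nu) (RtoC (/ r ^ (nu + 1)))) N))) =
  r ^ (N + 1) * (pr z - sum_n (fun nu => pr (beta nu) * / r ^ (nu + 1)) N).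
Proof.
  rewrite linear_Cmult_l, linear_Cminus, linear_Csum.
  do 2 f_equal. apply sum_n_ext. intros n. rewrite linear_Cmult_r. apply Rmult_comm.
Qed.

Lemma asymptotic_expansion_linear (phi : R -> C) (beta : nat -> C) :
  asymptotic_expansion phi beta ->
  real_expansion (fun r => pr (phi r)) (fun nu => pr (beta nu)).
Proof.
  intros H N.
  replace 0 with (pr (RtoC 0)).
  2:{ replace (RtoC 0) with (Cmult (RtoC 0) (RtoC 0)).
      - rewrite linear_Cmult_l. ring.
      - apply injective_projections; simpl; ring. }
  eapply filterlim_ext; [|eapply filterlim_comp; [exact (H N)
    | exact (linear_cont (U := C_R_NormedModule) pr _ Hpr)]].
  intros r. apply linear_remainder.
Qed.

(** With u = e^t and s = c t, e^t f(e^t) = b e^(s/c) A(s), which is b times the generating function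
    at x = 1/c. Its coefficients P_k(1/c) / k! supply [q]; the n-th derivative in t contributes c^n
    and n!. *)
Lemma appell_theta_1 (A : R -> C) (P : nat -> R -> C) (b c : R) (f : R -> C) :
  appell_family A P -> c <> 0 ->
  (forall u : R, 0 < u <= 1 -> f u = Cmult (RtoC b) (A (c * ln u))) ->
  smooth_on01 (fun u => pr (f u)) ->
  forall n, theta (fun u => pr (f u)) n 1 = b * c ^ n * pr (P n (1 / c)).
Proof.
  intros [_ HA] Hc Hf Hs n.
  destruct (HA (1 / c)) as [eps H].
  set (q := fun k => / INR (fact k) * pr (P k (1 / c))).
  assert (S : forall s, Rabs s < eps -> is_pseries q s (exp (1 / c * s) * pr (A s))).
  { intros s Hs'. rewrite <- linear_Cmult_l.
    apply is_pseries_ext with (fun k => pr (Cdiv (P k (1 / c)) (RtoC (INR (fact k))))).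
    - intros k. unfold q, Cdiv. rewrite <- RtoC_inv by apply INR_fact_neq_0.
      apply linear_Cmult_r.
    - apply is_pseries_linear, H.
      apply ball_R. now rewrite Rminus_0_r. }
  assert (Hca : 0 < Rabs c) by now apply Rabs_pos_lt.
  (* The radius [eps] in s = c t corresponds to eps / |c| in t. *)
  assert (B : forall t, - (eps / Rabs c) < t <= 0 -> Rabs (c * t) < eps).
  { intros t Ht. rewrite Rabs_mult, (Rabs_left1 t) by lra.
    replace (pos eps) with (Rabs c * (eps / Rabs c)) by (field; lra).
    apply Rmult_lt_compat_l; lra. }
  rewrite (theta_1_of_pseries _ q b c (eps / Rabs c)); auto.
  - unfold q. field. apply INR_fact_neq_0.
  - apply Rdiv_lt_0_compat; [apply cond_pos | exact Hca].
  - intros t Ht. exact (CV_radius_of_ball _ _ eps S _ (B t Ht)).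
  - intros t Ht. rewrite Hf, ln_exp.
    + rewrite linear_Cmult_l, (is_pseries_unique _ _ _ (S (c * t) (B t ltac:(lra)))).
      replace (1 / c * (c * t)) with t by (field; exact Hc). Rring.
    + split; [apply exp_pos|]. rewrite <- exp_0. left. apply exp_increasing. lra.
Qed.

End LinearFunctional.

(** * Recombination of real and imaginary parts *)

Lemma is_linear_Re : is_linear (U := C_R_NormedModule) (V := R_NormedModule) Re.
Proof. exact (is_linear_fst (U := R_NormedModule) (V := R_NormedModule)). Qed.

Lemma is_linear_Im : is_linear (U := C_R_NormedModule) (V := R_NormedModule) Im.
Proof. exact (is_linear_snd (U := R_NormedModule) (V := R_NormedModule)). Qed.

(** Balls in [C] are products of real balls here, so convergence is checked componentwise. *)
Lemma asymptotic_expansion_Re_Im (phi : R -> C) (beta : nat -> C) :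
  real_expansion (fun r => Re (phi r)) (fun nu => Re (beta nu)) ->
  real_expansion (fun r => Im (phi r)) (fun nu => Im (beta nu)) ->
  asymptotic_expansion phi beta.
Proof.
  intros H1 H2 N.
  apply (filterlim_locally (U := C_UniformSpace)). intros eps.
  generalize (filter_and _ _ (proj1 (filterlim_locally _ _) (H1 N) eps)
    (proj1 (filterlim_locally _ _) (H2 N) eps)).
  apply filter_imp. intros r [B1 B2]. split.
  - rewrite <- (linear_remainder _ is_linear_Re) in B1. exact B1.
  - rewrite <- (linear_remainder _ is_linear_Im) in B2. exact B2.
Qed.

Lemma moment_Re_Im (f : R -> C) (r : R) :
  smooth_on01 (fun u => Re (f u)) -> smooth_on01 (fun u => Im (f u)) -> 3 <= r ->
  moment f r = (RInt (fun u => Re (f u) * pospow r u) 0 1,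
                RInt (fun u => Im (f u) * pospow r u) 0 1).
Proof.
  intros H1 H2 Hr. unfold moment.
  apply (is_RInt_unique (V := C_R_CompleteNormedModule)).
  (* [Rpower] and [pospow] agree on the open interval, so the jump at 0 leaves the integral
     unchanged. *)
  assert (E : forall g, smooth_on01 g ->
    is_RInt (fun u => g u * Rpower u r) 0 1 (RInt (fun u => g u * pospow r u) 0 1)).
  { intros g Hg. apply is_RInt_ext with (fun u => g u * pospow r u).
    - intros u Hu. rewrite Rmin_left, Rmax_right in Hu by lra.
      now rewrite pospow_pos by lra.
    - apply (RInt_correct (V := R_CompleteNormedModule)).
      apply ex_RInt_ext with (fun u => theta g 0 u * pospow r u).
      + intros u _. now rewrite theta_0.
      + now apply RInt_theta. }
  apply (is_RInt_fct_extend_pair (U := R_NormedModule) (V := R_NormedModule)).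
  - eapply is_RInt_ext; [|exact (E _ H1)]. intros u _. unfold Re; simpl. ring.
  - eapply is_RInt_ext; [|exact (E _ H2)]. intros u _. unfold Im; simpl. ring.
Qed.

Lemma moment_coef_linear (pr : C -> R) (f : R -> C) (nu : nat) :
  is_linear (U := C_R_NormedModule) (V := R_NormedModule) pr ->
  (forall n, pr (CDerive_n f n 1) = Derive_n (fun u => pr (f u)) n 1) ->
  pr (moment_coef f nu) = real_coef (fun u => pr (f u)) nu.
Proof.
  intros Hpr HD. unfold moment_coef, real_coef, theta.
  rewrite (linear_Cmult_l _ Hpr), (linear_Csum _ Hpr). f_equal.
  apply sum_n_ext. intros n. rewrite (linear_Cmult_l _ Hpr), HD, pow1. Rring.
Qed.

Theorem theorem2p5 :
  forall (A : R -> C) (P : nat -> R -> C) (b c : R) (f : R -> C),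
    analytic_at A 0 ->
    appell_family A P ->
    b <> 0 ->
    c <> 0 ->
    (forall u : R, 0 < u <= 1 -> f u = Cmult (RtoC b) (A (c * ln u))) ->
    (forall u : R, 0 <= u <= 1 -> analytic_at f u) ->
    ex_RInt (fun u => Cmod (f u)) 0 1 ->
    asymptotic_expansion (moment f) (moment_coef f) /\
    (forall beta : nat -> C,
      asymptotic_expansion (moment f) beta ->
      forall nu : nat,
        beta nu = moment_coef f nu /\
        beta nu = Cmult (RtoC (b * (-1) ^ nu * c ^ nu)) (P nu (1 / c))).
Proof.
  intros A P b c f _ HP _ Hc Hf Han _.
  assert (S1 : smooth_on01 (fun u => Re (f u)))
    by (intros n u Hu; apply (analytic_at_linear _ is_linear_Re); auto).
  assert (S2 : smooth_on01 (fun u => Im (f u)))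
    by (intros n u Hu; apply (analytic_at_linear _ is_linear_Im); auto).
  assert (C1 : forall n, Re (moment_coef f n) = real_coef (fun u => Re (f u)) n)
    by (intros; apply (moment_coef_linear Re); auto using is_linear_Re).
  assert (C2 : forall n, Im (moment_coef f n) = real_coef (fun u => Im (f u)) n)
    by (intros; apply (moment_coef_linear Im); auto using is_linear_Im).
  assert (E1 := real_moment_expansion _ (fun r => Re (moment f r)) S1
    (fun r Hr => f_equal Re (moment_Re_Im f r S1 S2 Hr))).
  assert (E2 := real_moment_expansion _ (fun r => Im (moment f r)) S2
    (fun r Hr => f_equal Im (moment_Re_Im f r S1 S2 Hr))).
  assert (T1 := appell_theta_1 _ is_linear_Re A P b c f HP Hc Hf S1).
  assert (T2 := appell_theta_1 _ is_linear_Im A P b c f HP Hc Hf S2).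
  assert (HE : asymptotic_expansion (moment f) (moment_coef f)).
  { apply asymptotic_expansion_Re_Im.
    - exact (real_expansion_ext _ _ _ (fun n => eq_sym (C1 n)) E1).
    - exact (real_expansion_ext _ _ _ (fun n => eq_sym (C2 n)) E2). }
  split; [exact HE|]. intros beta Hb nu.
  (* Both sequences expand the same moment, so uniqueness applies to each component. *)
  assert (Eb : beta nu = moment_coef f nu).
  { apply injective_projections.
    - exact (real_expansion_unique _ _ _ (asymptotic_expansion_linear _ is_linear_Re _ _ Hb)
        (asymptotic_expansion_linear _ is_linear_Re _ _ HE) nu).
    - exact (real_expansion_unique _ _ _ (asymptotic_expansion_linear _ is_linear_Im _ _ Hb)
        (asymptotic_expansion_linear _ is_linear_Im _ _ HE) nu). }
  split; [exact Eb|]. rewrite Eb.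
  (* In each component the coefficient is (-1)^nu theta_nu(1), and the generating function gives
     theta_nu(1). *)
  apply injective_projections.
  - change (Re (moment_coef f nu) = Re (Cmult (RtoC (b * (-1) ^ nu * c ^ nu)) (P nu (1 / c)))).
    rewrite C1, (linear_Cmult_l _ is_linear_Re). unfold real_coef. rewrite T1. ring.
  - change (Im (moment_coef f nu) = Im (Cmult (RtoC (b * (-1) ^ nu * c ^ nu)) (P nu (1 / c)))).
    rewrite C2, (linear_Cmult_l _ is_linear_Im). unfold real_coef. rewrite T2. ring.
Qed.
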